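(* Let $m>1$ be an integer and let $\mathrm{Art}_m=\langle a,b\mid (a,b)_m=(b,a)_m\rangle$. Every nontrivial (i.e. nonempty) cyclically reduced word over $\{a,b,a^{-1},b^{-1}\}$ that is equal to the identity in $\mathrm{Art}_m$ contains at least $2m$ syllables.
   Context: For letters $a,b$ and an integer $m\ge 1$, $(a,b)_m$ denotes the positive word of length $m$ that starts with $a$ and alternates between $a$ and $b$ (e.g. $(a,b)_3=aba$, $(a,b)_4=abab$), and similarly $(b,a)_m$ starts with $b$. A word is cyclically reduced if it and all of its cyclic permutations are freely reduced. A syllable of a word is a maximal subword (block of consecutive letters) that merely repeats the same letter of $\{a,b,a^{-1},b^{-1}\}$; for example $a^5b^2a^{-4}$ has three syllables $a^5$, $b^2$, $a^{-4}$. *)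

(* Defs.v *)
From mathcomp Require Import all_boot.
Set Implicit Arguments.
Unset Strict Implicit.
Unset Printing Implicit Defensive.

(* The four letters a, b, a^-1, b^-1: the first component selects the
   generator (false for a, true for b), the second one tells whether the
   letter is inverted. *)
Definition letter : Type := (bool * bool)%type.
Definition la : letter := (false, false).
Definition lb : letter := (true, false).
Definition linv (x : letter) : letter := (x.1, ~~ x.2).

Definition word : Type := seq letter.

Fixpoint alt_word (x y : letter) (m : nat) : word :=
  if m is m'.+1 then x :: alt_word y x m' else [::].

(* [art_eq m u v]: the words u and v represent the same element of
   Art_m = < a, b | (a,b)_m = (b,a)_m >, i.e. they are related by the least
   congruence on words that identifies x x^-1 with the empty word for each of
   the four letters x, and the two sides of the defining relation. *)
Inductive art_eq (m : nat) : word -> word -> Prop :=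
| art_refl u : art_eq m u u
| art_sym u v : art_eq m u v -> art_eq m v u
| art_trans u v w : art_eq m u v -> art_eq m v w -> art_eq m u w
| art_cat u u' v v' :
    art_eq m u u' -> art_eq m v v' -> art_eq m (u ++ v) (u' ++ v')
| art_cancel x : art_eq m [:: x; linv x] [::]
| art_braid : art_eq m (alt_word la lb m) (alt_word lb la m).

(* [sorted r w] only constrains pairs of consecutive letters of w. *)
Definition freely_reduced (w : word) : bool :=
  sorted (fun x y => y != linv x) w.

Definition cyclically_reduced (w : word) : Prop :=
  forall n : nat, freely_reduced (rot n w).

(* The subword of w made of the letters at positions i, ..., j - 1. *)
Definition subword (w : word) (i j : nat) : word := take (j - i) (drop i w).

(* A syllable is an occurrence of a nonempty constant subword, given by its
   bounds i < j, that no constant subword properly extends. The first and last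
   syllables of w are not merged, even if they repeat the same letter. *)
Definition is_syllable (w : word) (i j : nat) : bool :=
  [&& i < j, j <= size w, constant (subword w i j)
    & [forall i' : 'I_(size w).+1, forall j' : 'I_(size w).+1,
         [&& i' <= i, j <= j' & constant (subword w i' j')]
         ==> (i' == i :> nat) && (j' == j :> nat)]].

Definition num_syllables (w : word) : nat :=
  #|[set p : 'I_(size w).+1 * 'I_(size w).+1 | is_syllable w p.1 p.2]|.

(* Main.v *)
Require Import Defs.
From mathcomp Require Import all_boot zify.
Set Implicit Arguments.
Unset Strict Implicit.
Unset Printing Implicit Defensive.

(** Let s be the automorphism of Z/m * Z/m = <x> * <y> that exchanges x and y.
  Then a |-> x s, b |-> y s defines a morphism from Art_m to the semidirect
  product of Z/m * Z/m by <s>: both sides of the relation go to s^m. Call a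
  pair of consecutive letters of w a stay if it has equal signs and distinct
  generators. In the image of a freely reduced word, two consecutive letters
  contribute to the same free factor, with the same sign, exactly at a stay.
  Hence, by the normal form theorem, a nonempty freely reduced word whose
  Z/m * Z/m component is trivial contains an alternating block of m letters of
  the same sign. Write w = u B v with B such a block: B maps to a power of s,
  so v u also has trivial component, and it is nonempty because the exponent
  sum of w is 0; thus v u contains another block. This gives 2(m - 1) stays in
  the cyclic word w, and as the exponent sum is 0 there are at least two cyclic
  sign changes as well. *)

(** * Normal forms in Z/m * Z/m and the action of words on them *)

Section FreeProduct.

Variable m : nat.
Hypothesis m_gt1 : 1 < m.

(* (t, i) :: l is the i-th power of the generator t, times l. *)
Definition nform : Type := seq (bool * nat).

Definition valid (l : nform) : bool :=
  sorted (fun p q => p.1 != q.1) l && all (fun p => 0 < p.2 < m) l.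

Definition mul (t : bool) (l : nform) : nform :=
  if l is (t', i) :: l' then
    if t' == t then if i.+1 == m then l' else (t, i.+1) :: l'
    else (t, 1) :: l
  else [:: (t, 1)].

Definition mulV (t : bool) (l : nform) : nform :=
  if l is (t', i) :: l' then
    if t' == t then if i == 1 then l' else (t, i.-1) :: l'
    else (t, m.-1) :: l
  else [:: (t, m.-1)].

Lemma valid_cons t i l :
  valid ((t, i) :: l) =
  [&& 0 < i < m, (if l is (t', _) :: _ then t != t' else true) & valid l].
Proof.
rewrite /valid /=; case: l => [|[t' i'] l] /=; first by rewrite !andbT.
by case: (t != t') => /=; rewrite ?andbF //= andbCA.
Qed.

Lemma valid_mul t l : valid l -> valid (mul t l).
Proof.
case: l => [|[t' i] l] /= => [_|]; first by rewrite valid_cons /= m_gt1.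
rewrite valid_cons => /and3P[i_bd hd vl].
case: eqP => [<-|/eqP ne].
  case: eqP => // i1m; rewrite valid_cons hd vl !andbT; lia.
by rewrite !valid_cons i_bd hd vl /= m_gt1 eq_sym ne.
Qed.

Lemma valid_mulV t l : valid l -> valid (mulV t l).
Proof.
case: l => [|[t' i] l] /= => [_|]; first by rewrite valid_cons /= andbT; lia.
rewrite valid_cons => /and3P[i_bd hd vl].
case: eqP => [<-|/eqP ne].
  case: eqP => // i1; rewrite valid_cons hd vl !andbT; lia.
rewrite !valid_cons i_bd hd vl /= eq_sym ne !andbT; lia.
Qed.

Lemma mulK t l : valid l -> mulV t (mul t l) = l.
Proof.
case: l => [|[t' i] l] /= => [_|]; first by rewrite eqxx.
rewrite valid_cons => /and3P[i_bd hd vl].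
case: eqP => [<-|_] /=; last by rewrite eqxx.
case: eqP => [i1m|_] /=; last by rewrite eqxx; case: eqP => //; lia.
have -> : i = m.-1 by lia.
by case: l hd {vl} => [|[t2 j] l] //=; rewrite eq_sym => /negPf ->.
Qed.

Lemma mulVK t l : valid l -> mul t (mulV t l) = l.
Proof.
have m1 : m.-1.+1 = m by lia.
case: l => [|[t' i] l] /= => [_|]; first by rewrite m1 !eqxx.
rewrite valid_cons => /and3P[i_bd hd vl].
case: eqP => [<-|_] /=; last by rewrite m1 !eqxx.
case: eqP => [->|i1] /=; last by rewrite eqxx; case: eqP => [|_]; [lia|congr ((_, _) :: _); lia].
by case: l hd {vl} => [|[t2 j] l] //=; rewrite eq_sym => /negPf ->.
Qed.

Lemma iter_mul_cons t k l :
  (if l is (t', _) :: _ then t != t' else true) ->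
  0 < k < m -> iter k (mul t) l = (t, k) :: l.
Proof.
move=> hd; elim: k => // -[|k] IHk kb /=.
  by case: l hd {IHk} => [|[t' j] l] //=; rewrite eq_sym => /negPf ->.
by rewrite -/(iter k.+1 _ _) IHk /= ?eqxx; [case: eqP => //; lia | lia].
Qed.

Lemma iter_mul t l : valid l -> iter m (mul t) l = l.
Proof.
have free_case l0 : (if l0 is (t', _) :: _ then t != t' else true) ->
    iter m (mul t) l0 = l0.
  move=> hd; have -> : m = m.-1.+1 by lia.
  rewrite iterS iter_mul_cons //=; last by lia.
  by rewrite eqxx; case: eqP => //; lia.
case: l => [|[t' i] l] => [_|]; first exact: free_case.
rewrite valid_cons => /and3P[i_bd hd vl].
have [ett|ne] := eqVneq t t'; last exact: free_case.
rewrite -ett in hd *.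
(* A head [(t, i)] is read as [i] further multiplications by [t], which commute with the [m] given
   ones. *)
by rewrite -iter_mul_cons // -iterD addnC iterD free_case.
Qed.

(* The state (e, l) stands for p s^e with e mod 2, where l spells p backwards,
   and act x multiplies it by x on the right. Hence foldr act computes the image
   of the reversed word; this is harmless as reversal preserves the relation. *)
Definition act (x : letter) (s : bool * nform) : bool * nform :=
  (~~ s.1, (if x.2 then mulV else mul) (x.1 (+) s.1 (+) x.2) s.2).

Lemma valid_act x s : valid s.2 -> valid (act x s).2.
Proof. by move=> vs; rewrite /act /=; case: x.2; rewrite ?valid_mul ?valid_mulV. Qed.

Lemma valid_foldr_act w s : valid s.2 -> valid (foldr act s w).2.
Proof. by move=> vs; elim: w => //= x w IHw; apply: valid_act. Qed.

(** As (x s)^-1 = s^-1 x^-1 = y^-1 s^-1, an inverse letter acts through the other factor; the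
    summand [x.2] in [act] accounts for this. *)
Lemma act_linv x s : valid s.2 -> act x (act (linv x) s) = s.
Proof.
case: x s => [g []] [e l] vl; rewrite /act /= negbK.
  by rewrite !addbF addbN -addNb addbT addNb negbK mulK.
by rewrite !addbF addbN addbT mulVK.
Qed.

Definition flip (x : letter) : letter := (~~ x.1, x.2).

Lemma flipK : involutive flip.
Proof. by case=> g s; rewrite /flip /= negbK. Qed.

(* All letters of an alternating word multiply by the same free factor. *)
Lemma foldr_act_alt x n s :
  foldr act s (alt_word x (flip x) n) =
  (odd n (+) s.1,
   iter n ((if x.2 then mulV else mul) (~~ x.1 (+) odd n (+) s.1 (+) x.2)) s.2).
Proof.
elim: n x => [|n IHn] x; first by case: s.
have := IHn (flip x); rewrite flipK /= => ->.
rewrite /act /= !negbK -addNb addbA.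
by have -> : ~~ x.1 (+) ~~ odd n (+) s.1 (+) x.2 = x.1 (+) odd n (+) s.1 (+) x.2
  by case: x.1 (odd n) => [] [].
Qed.

Lemma foldr_act_alt_full x s : valid s.2 ->
  foldr act s (alt_word x (flip x) m) = (odd m (+) s.1, s.2).
Proof.
move=> vs; rewrite foldr_act_alt; congr pair; set t := (_ (+) x.2).
case: x.2; last exact: iter_mul.
have vi n l : valid l -> valid (iter n (mul t) l).
  by move=> vl; elim: n => //= n; apply: valid_mul.
have itK n l : valid l -> iter n (mulV t) (iter n (mul t) l) = l.
  by move=> vl; elim: n => // n IHn; rewrite iterSr iterS mulK ?vi.
by rewrite -{1}(iter_mul t vs) itK.
Qed.

Lemma foldr_act_art_eq u v : art_eq m u v ->
  forall s, valid s.2 -> foldr act s u = foldr act s v.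
Proof.
elim=> {u v} [u|u v _ IH|u v w _ IHu _ IHv|u u' v v' _ IHu _ IHv|x|] s vs //.
- by rewrite IH.
- by rewrite IHu // IHv.
- by rewrite !foldr_cat IHv // IHu // valid_foldr_act.
- exact: act_linv.
by rewrite (foldr_act_alt_full la) // (foldr_act_alt_full lb).
Qed.

(** Letters act from right to left, so the head of the normal form comes from the start of the word.
    A stay lengthens both the initial block and the head power, up to sign; any other reduced pair
    opens a new head in the other factor. The head can only vanish once the block reaches length
    [m]. *)
Lemma reduced_alt_block e x w : freely_reduced (x :: w) ->
  (exists u y v, x :: w = u ++ alt_word y (flip y) m ++ v) \/
  exists d v e' l, [/\ 0 < d < m, x :: w = alt_word x (flip x) d ++ v
    & foldr act (e, [::]) (x :: w) =
      (e', (x.1 (+) ~~ e' (+) x.2, if x.2 then m - d else d) :: l)].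
Proof.
elim: w x => [|y w IHw] x.
  right; exists 1, [::], (~~ e), [::]; split=> //=.
  by rewrite /act /= negbK; case: x.2; rewrite ?subn1.
rewrite /freely_reduced [sorted _ _]/= => /andP[yx /IHw].
case=> [[u [z [v ->]]]|[d [v [e' [l [d_bd eqw acw]]]]]].
  by left; exists (x :: u), z, v.
(* Either a stay, or generator and sign both agree or both differ. *)
have {yx} [yx|ny] : y = flip x \/ y.1 (+) y.2 = x.1 (+) x.2.
  case: x y yx {eqw acw} => [[] []] [[] []] /= h; by [left|right|case/eqP: h].
- have eqxw : x :: y :: w = alt_word x (flip x) d.+1 ++ v.
    by rewrite eqw yx flipK.
  have [d1m|d1m] := eqVneq d.+1 m.
    by left; exists [::], x, v; rewrite eqxw d1m.
  right; exists d.+1, v, (~~ e'), l; split=> //; first by lia.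
  rewrite [foldr _ _ _]/= -/(foldr act (e, [::]) (y :: w)) acw /act yx /= negbK.
  have -> : ~~ x.1 (+) ~~ e' (+) x.2 = x.1 (+) e' (+) x.2.
    by rewrite addNb addbN negbK.
  case: x.2 => /=; rewrite eqxx; last by case: eqP d1m.
  by case: eqP => [|_]; [lia|congr (_, (_, _) :: _); lia].
- right; exists 1, (y :: w), (~~ e'), (foldr act (e, [::]) (y :: w)).2; split=> //.
  rewrite [foldr _ _ _]/= -/(foldr act (e, [::]) (y :: w)) acw /act /= negbK.
  have -> : y.1 (+) ~~ e' (+) y.2 = ~~ (x.1 (+) e' (+) x.2).
    by rewrite addbN addNb addbAC ny addbAC.
  have neqt t : (~~ t == t) = false by case: t.
  by case: x.2 => /=; rewrite neqt ?subn1.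
Qed.

Lemma art_trivial_alt_block e w : w <> [::] -> freely_reduced w ->
  (foldr act (e, [::]) w).2 = [::] ->
  exists u y v, w = u ++ alt_word y (flip y) m ++ v.
Proof.
case: w => // x w _ red act0.
by have [//|[d [v [e' [l [_ _ acw]]]]]] := reduced_alt_block e red; rewrite acw in act0.
Qed.

End FreeProduct.

(** * Conjugation and exponent sum *)

Section Words.

Variable m : nat.

Lemma linvK : involutive linv.
Proof. by case=> g s; rewrite /linv /= negbK. Qed.

(** Conjugation moves the letters of [u] to the end one at a time. *)
Lemma art_eq_rot u v : art_eq m (u ++ v) [::] -> art_eq m (v ++ u) [::].
Proof.
elim: u v => [|x u IHu] v; first by rewrite cats0.
move=> xuv; rewrite -cat1s catA; apply: IHu; rewrite catA.
set w := u ++ v in xuv *.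
have lx : art_eq m [:: linv x; x] [::] by have := art_cancel m (linv x); rewrite linvK.
have cancel : art_eq m ([:: linv x; x] ++ (w ++ [:: x])) (w ++ [:: x]).
  exact: art_cat lx (art_refl _ _).
apply: art_trans (art_sym cancel) _; apply: art_trans _ lx.
exact: (art_cat (art_refl m [:: linv x]) (art_cat xuv (art_refl m [:: x]))).
Qed.

Notation neg := (fun x : letter => x.2).

Lemma count_neg_alt x n : count neg (alt_word x (flip x) n) = x.2 * n.
Proof.
elim: n x => [|n IHn] x /=; first by rewrite muln0.
by have := IHn (flip x); rewrite flipK => ->; rewrite mulnS.
Qed.

Lemma size_alt x y n : size (alt_word x y n) = n.
Proof. by elim: n x y => //= n IHn x y; rewrite IHn. Qed.

(** The exponent sum is the size minus twice the number of inverse letters; its invariance is stated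
    without subtraction. *)
Lemma art_eq_exponent_sum u v : art_eq m u v ->
  2 * count neg u + size v = 2 * count neg v + size u.
Proof.
elim=> {u v} [u|u v _ IH|u v w _ IHu _ IHv|u u' v v' _ IHu _ IHv|x|]; try lia.
- rewrite !count_cat !size_cat; lia.
- by case: x => [g []].
- by rewrite (count_neg_alt la) (count_neg_alt lb) !size_alt.
Qed.

End Words.

(** * Counting stays and sign changes *)

Definition breaks (r : rel letter) (x : letter) (w : word) : nat :=
  count id (pairmap r x w).

Definition same_sign_break : rel letter := [rel x y | y == flip x].
Definition sign_break : rel letter := [rel x y | x.2 != y.2].
Definition letter_break : rel letter := [rel x y | x != y].

Lemma breaks_cat r x u v :
  breaks r x (u ++ v) = breaks r x u + breaks r (last x u) v.
Proof. by rewrite /breaks pairmap_cat count_cat. Qed.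

(** Stays and sign changes exclude each other, and both change the letter. *)
Lemma letter_break_ge x w :
  breaks same_sign_break x w + breaks sign_break x w <= breaks letter_break x w.
Proof.
rewrite /breaks; elim: w x => //= y w IHw x; have := IHw y.
case: x y {IHw} => [[] []] [[] []] /=; lia.
Qed.

Lemma sign_break_last x w : (last x w).2 != x.2 -> 0 < breaks sign_break x w.
Proof.
rewrite /breaks; elim: w x => [|y w IHw] x /=; first by rewrite eqxx.
rewrite [sign_break x y]/(x.2 != y.2).
by have [->|_] := eqVneq x.2 y.2; [move=> /IHw|].
Qed.

(** The sign changes on the way to a letter of opposite sign, and again on the way back. *)
Lemma sign_break_closed x w : last x w = x ->
  has (fun y => y.2 != x.2) w -> 2 <= breaks sign_break x w.
Proof.
move=> + mixed; case/split_find: mixed => y p q yx _.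
rewrite last_cat last_rcons breaks_cat last_rcons => qx.
by apply: (@leq_add 1 1); apply: sign_break_last; rewrite ?last_rcons ?qx // eq_sym.
Qed.

Lemma same_sign_break_alt x y n :
  n.-1 <= breaks same_sign_break x (alt_word y (flip y) n).
Proof.
(* The pair joining [x] to the block is dropped. *)
case: n => //= n; rewrite /breaks /=; apply: leq_trans (leq_addl _ _).
elim: n y => //= n IHn y; rewrite [same_sign_break _ _]eqxx add1n ltnS.
by have := IHn (flip y); rewrite flipK.
Qed.

(** * Letter changes as starting points of syllables *)

Lemma count_nth_card (s : seq bool) n : size s <= n ->
  count id s = #|[set i : 'I_n | nth false s i]|.
Proof.
move=> sn; rewrite -sum1dep_card big_mkcond /=.
elim: s n sn => [|b s IHs] [|n] //= sn.
- by rewrite big_ord0.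
- by rewrite big1 // => i _; rewrite nth_nil.
- by rewrite big_ord_recl /= (IHs n) //; case: b.
Qed.

Lemma constant_nth (x : letter) s i j : constant s -> i < size s -> j < size s ->
  nth x s i = nth x s j.
Proof. by case/(constantP x) => y -> ; rewrite size_nseq !nth_nseq => -> ->. Qed.

Lemma subword_constant_nth x w i j k l :
  constant (subword w i j) -> j <= size w -> i <= k < j -> i <= l < j ->
  nth x w k = nth x w l.
Proof.
move=> cst jw kb lb.
have nth_sub n : i <= n < j -> nth x w n = nth x (subword w i j) (n - i).
  case/andP=> i_n n_j; rewrite /subword nth_take ?nth_drop ?subnKC //; lia.
have size_sub : size (subword w i j) = j - i.
  by rewrite /subword size_takel // size_drop leq_sub2r.
by rewrite !nth_sub //; apply: constant_nth => //; rewrite size_sub; lia.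
Qed.

(** The longest constant subword from [i] works: [start] rules out any extension to the left. *)
Lemma syllable_at x w i : i < size w ->
  (0 < i -> nth x w i.-1 != nth x w i) -> exists j, is_syllable w i j.
Proof.
move=> iw start.
pose P j := [&& i < j, j <= size w & constant (subword w i j)].
have exP : exists j, P j.
  by exists i.+1; rewrite /P ltnSn iw /subword subSnn (drop_nth x iw) /= take0.
have ubP j : P j -> j <= size w by case/and3P.
case: (ex_maxnP exP ubP) => j /and3P[ij jw cst] maxj.
exists j; rewrite /is_syllable ij jw cst /=.
apply/forallP=> i'; apply/forallP=> j'; apply/implyP=> /and3P[i'i jj' cst'].
have j'w : j' <= size w by rewrite -ltnS.
have {i'i} ei : i' = i :> nat.
  apply/eqP; rewrite eqn_leq i'i leqNgt; apply/negP=> lti.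
  have := start (leq_ltn_trans (leq0n _) lti); case/eqP.
  by apply: (subword_constant_nth x cst') => //; move: lti ij jj'; clear; lia.
rewrite ei eqxx /= eqn_leq jj' andbT; apply: maxj.
by rewrite /P (leq_trans ij jj') j'w -ei.
Qed.

(* For x the last letter of w, the left side counts the syllables of w as a
   cyclic word. *)
Lemma breaks_num_syllables x w : breaks letter_break x w <= num_syllables w.
Proof.
rewrite /breaks (@count_nth_card _ (size w).+1) ?size_pairmap //.
(* Syllables are projected to their starting positions, which include every position where the
   letter changes. *)
apply: leq_trans (leq_imset_card (fun p => p.1) _).
apply/subset_leq_card/subsetP=> i; rewrite inE => brk.
have iw : i < size w.
  by rewrite ltnNge; apply/negP=> wi; rewrite nth_default ?size_pairmap in brk.
rewrite (nth_pairmap x) // in brk.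
have [|j syl] := @syllable_at x w i iw; first by case: (nat_of_ord i) brk.
have jw : j < (size w).+1 by case/and4P: syl.
by apply/imsetP; exists (i, Ordinal jw); rewrite ?inE.
Qed.

Theorem proposition6p5 (m : nat) (hm : 1 < m) (w : word) (hw : w <> [::])
    (hred : cyclically_reduced w) (hid : art_eq m w [::]) :
  2 * m <= num_syllables w.
Proof.
have expw := art_eq_exponent_sum hid; rewrite /= addn0 muln0 add0n in expw.
have act_w := foldr_act_art_eq hm hid.
(* Starting from the last letter makes the counts cyclic. *)
set z := last la w.
have lastz : last z w = z by rewrite /z; case: (w) hw.
apply: leq_trans (breaks_num_syllables z w).
apply: leq_trans (letter_break_ge z w).
(* With exponent sum 0, both signs occur in [w]. *)
have sign2 : 2 <= breaks sign_break z w.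
  apply: sign_break_closed => //; apply/negPn/negP => /hasPn same.
  have {}same : {in w, (fun x : letter => x.2) =1 fun=> z.2}.
    by move=> x /same; rewrite negbK => /eqP.
  rewrite (eq_in_count same) in expw.
  have size_gt0 : 0 < size w by case: (w) hw.
  have count_neg : count (fun=> z.2) w = z.2 * size w.
    by case: z.2; rewrite ?mul1n ?count_predT ?count_pred0.
  move: expw; rewrite count_neg; move: (size w) size_gt0; case: z.2 => /=; lia.
have w_red : freely_reduced w by have := hred 0; rewrite rot0.
have [|u [y [v w_split]]] := @art_trivial_alt_block m hm false w hw w_red.
  by rewrite act_w.
set B := alt_word y (flip y) m in w_split.
have rot_w : rot (size (u ++ B)) w = (v ++ u) ++ B.
  by rewrite w_split catA rot_size_cat catA.
have vu_red : freely_reduced (v ++ u).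
  by have := hred (size (u ++ B)); rewrite rot_w => /cat_sorted2[].
have vu_neq0 : v ++ u <> [::].
  move=> vu0; have [v0 u0] : v = [::] /\ u = [::] by case: (v) vu0.
  rewrite w_split v0 u0 cats0 /= /B count_neg_alt size_alt in expw.
  by move: expw; case: y.2 => /=; lia.
have vu_triv : art_eq m ((v ++ u) ++ B) [::].
  by rewrite -catA; apply: art_eq_rot; rewrite -catA -w_split.
(* The initial parity [odd m] is the state left by [B]. *)
have act_vu : (foldr (act m) (odd m, [::]) (v ++ u)).2 = [::].
  have := foldr_act_art_eq hm vu_triv (s := (false, [::])) isT.
  by rewrite foldr_cat foldr_act_alt_full //= addbF => ->.
have [u' [y' [v' vu_split]]] := art_trivial_alt_block hm vu_neq0 vu_red act_vu.
have breaks_w : breaks same_sign_break z w =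
    breaks same_sign_break (last z u) B +
    breaks same_sign_break (last (last z u) B) (v ++ u).
  (* After [B] and [v] the cyclic reading is back at [z], so the pairs outside [B] are those of
     [v ++ u] read after [B]. *)
  have lastv : last (last (last z u) B) v = z by rewrite -[RHS]lastz w_split !last_cat.
  by rewrite [in LHS]w_split !breaks_cat lastv; lia.
have blockB := same_sign_break_alt (last z u) y m.
have blockB' : m.-1 <= breaks same_sign_break (last (last z u) B) (v ++ u).
  rewrite vu_split !breaks_cat addnCA.
  exact: leq_trans (same_sign_break_alt _ _ _) (leq_addr _ _).
rewrite breaks_w; move: blockB; rewrite -/B; lia.
Qed.
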